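(* Let $(\Lambda,\to_{p})$ be a pure calculus and $(\Lambda^X,\to)$ a calculus with explicit substitutions with $\Lambda\subset\Lambda^X$. Let $T$ be a typing system for the pure calculus and $T'$ a typing system for the calculus with explicit substitutions, and assume that every pure term typable with respect to $T$ is strongly normalizing in the pure calculus. Suppose that there exists a function $\mathit{Ateb}:\Lambda^X\to\Lambda$ such that: (Preservation of typability) for every $t\in\Lambda^X$ typable with respect to $T'$, the pure term $\mathit{Ateb}(t)$ is typable with respect to $T$ in the pure calculus; (Initialization) $\mathit{Ateb}(t)$ reduces to $t$ in zero or more steps of $\to$. Then PSN implies SN with respect to $T'$. That is, if every pure term that is strongly normalizing for $\to_p$ is strongly normalizing for $\to$, then every term of $\Lambda^X$ typable with respect to $T'$ is strongly normalizing for $\to$.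
   Context: A calculus is a set of terms with a reduction relation. A pure calculus $(\Lambda,\to_p)$ has no explicit substitutions. A calculus with explicit substitutions $(\Lambda^X,\to)$ has as terms a set $\Lambda^X$ containing the pure terms $\Lambda$. A typing system singles out a subset of typable terms. A term is strongly normalizing for a reduction relation if there is no infinite reduction sequence starting from it. PSN (preservation of strong normalization): every pure term strongly normalizing in the pure calculus is strongly normalizing in the calculus with explicit substitutions. SN (with respect to a typing system): every typable term is strongly normalizing in the calculus with explicit substitutions. *)

(* Defs.v *)
From Stdlib Require Export Relations.

Set Implicit Arguments.
Unset Strict Implicit.
Unset Printing Implicit Defensive.

Record calculus : Type := Calculus {
  term :> Type;
  red : relation term
}.

(* The inclusion of pure terms is an injection rather than a subset type; it is
   not assumed to relate the two reductions. *)
Record explicit_calculus (P : calculus) : Type := ExplicitCalculus {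
  full_calculus :> calculus;
  pure_term : P -> full_calculus;
  pure_term_inj : forall s t : P, pure_term s = pure_term t -> s = t
}.

Record typing_system (C : calculus) : Type := TypingSystem {
  typable : C -> Prop
}.

Definition reduces (C : calculus) : relation C :=
  clos_refl_trans C (red (c := C)).

Definition infinite_reduction (C : calculus) (t : C) (u : nat -> C) : Prop :=
  u 0 = t /\ forall n : nat, red (u n) (u (S n)).

Definition strongly_normalizing (C : calculus) (t : C) : Prop :=
  ~ exists u : nat -> C, infinite_reduction t u.

Definition SN (C : calculus) (T : typing_system C) : Prop :=
  forall t : C, typable T t -> strongly_normalizing t.

Definition PSN (P : calculus) (X : explicit_calculus P) : Prop :=
  forall t : P, strongly_normalizing t -> strongly_normalizing (pure_term X t).

Definition preservation_of_typability (P : calculus) (X : explicit_calculus P)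
    (T : typing_system P) (T' : typing_system X) (Ateb : X -> P) : Prop :=
  forall t : X, typable T' t -> typable T (Ateb t).

Definition initialization (P : calculus) (X : explicit_calculus P)
    (Ateb : X -> P) : Prop :=
  forall t : X, reduces (pure_term X (Ateb t)) t.

(* Main.v *)
Require Import Defs.

(** Strong normalization passes to reducts. If [t] is typable, so is [Ateb t], which is thus
    strongly normalizing in the pure calculus and, by PSN, in the explicit one; since its image
    there reduces to [t], [t] inherits the property. *)

Lemma strongly_normalizing_red (C : calculus) (s t : C) :
  red s t -> strongly_normalizing s -> strongly_normalizing t.
Proof.
  intros Hst Hs [u [Hu0 Hu]].
  apply Hs.
  (* Prepend [s] to the infinite reduction from [t]: step 0 is [Hst], and later steps are those of
     [u] shifted by one. *)
  exists (fun n => match n with 0 => s | S m => u m end).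
  split; [reflexivity |].
  intros [| n]; [rewrite Hu0; exact Hst | apply Hu].
Qed.

Lemma strongly_normalizing_reduces (C : calculus) (s t : C) :
  reduces s t -> strongly_normalizing s -> strongly_normalizing t.
Proof.
  intros Hst.
  induction Hst as [s t Hst | s | s r t _ IHsr _ IHrt]; auto.
  exact (strongly_normalizing_red C s t Hst).
Qed.

Theorem theorem2p3 (P : calculus) (X : explicit_calculus P)
    (T : typing_system P) (T' : typing_system X)
    (pure_SN : SN T)
    (Ateb_exists : exists Ateb : X -> P,
      preservation_of_typability T T' Ateb /\ initialization Ateb) :
  PSN X -> SN T'.
Proof.
  intros HPSN t Ht.
  destruct Ateb_exists as [Ateb [Htyp Hinit]].
  apply (strongly_normalizing_reduces X (pure_term X (Ateb t)) t (Hinit t)).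
  apply HPSN, pure_SN, Htyp, Ht.
Qed.
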